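(* Let $\Sigma=(A,B,C,D)$ be a system satisfying the standing assumptions, Assumption 1 and Assumption 2 of the context. Let $h=\dim\mathcal{V}^\star_g$ and let $\lambda_1,\ldots,\lambda_p\in\Lambda_g\setminus\mathcal{Z}$. Then Problem 3 (for $\lambda_1,\ldots,\lambda_p$) is solvable if and only if $$\dim\Big(\mathcal{V}^\star_g+\sum_{j\in S}\mathcal{R}^\star_j(\lambda_j)\Big)\ \ge\ n-p+\mathrm{card}(S)$$ for every subset $S\subseteq\{1,\ldots,p\}$ with $\mathrm{card}(S)>h-(n-p)$.
   Context: The system $\Sigma$ is $\mathcal{D}x=Ax+Bu$, $y=Cx+Du$, with real constant matrices, $x(t)\in\mathcal{X}=\mathbb{R}^n$, $u(t)\in\mathcal{U}=\mathbb{R}^m$, $y(t)\in\mathcal{Y}=\mathbb{R}^p$. Either continuous time ($t\in\mathbb{R}^+$, $\mathcal{D}x=\dot x$, $\mathbb{C}_g$ = open left half-plane, $\Lambda_g=(-\infty,0)$) or discrete time ($t\in\mathbb{N}$, $\mathcal{D}x(t)=x(t+1)$, $\mathbb{C}_g$ = open unit disc, $\Lambda_g=[0,1)$, convention $0^0=1$). A matrix is asymptotically stable if its spectrum lies in $\mathbb{C}_g$. Standing assumptions: the columns of $\begin{bmatrix} B \\ D \end{bmatrix}$ are linearly independent, and the rows of $[\,C\ \ D\,]$ are linearly independent. Rosenbrock matrix: $P_\Sigma(\lambda)=\begin{bmatrix} A-\lambda I_n & B \\ C & D \end{bmatrix}$. The set $\mathcal{Z}$ of invariant zeros of $\Sigma$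 is the set of $\lambda\in\mathbb{C}$ at which $\mathrm{rank}\,P_\Sigma(\lambda)$ is smaller than its normal rank; algebraic multiplicities are those of the zeros as roots of the product of the nonzero polynomials of the Smith form of $P_\Sigma$. Minimum-phase invariant zeros are those in $\mathbb{C}_g$. Assumption 1: $\Sigma$ is right invertible (i.e. $P_\Sigma(\lambda)$ has full row rank $n+p$ for all but finitely many $\lambda$), $(A,B)$ is stabilisable, and $\Sigma$ has no invariant zero at $0$ (continuous time), respectively at $1$ (discrete time). Assumption 2: all minimum-phase invariant zeros of $\Sigma$ have algebraic multiplicity one. $\mathcal{V}^\star_g$ is the largest subspace $\mathcal{V}\subseteq\mathcal{X}$ for which there is $F\in\mathbb{R}^{m\times n}$ with $(A+BF)\mathcal{V}\subseteq\mathcal{V}\subseteq\ker(C+DF)$ and $\sigma(A+BF\,|\,\mathcal{V})\subset\mathbb{C}_g$. For $j\in\{1,\ldots,p\}$, $C_{(j)},D_{(j)}$ are $C,D$ with the $j$-th row deleted, and for $\mu\in\mathbb{R}\setminus\mathcal{Z}$, $\mathcal{R}^\star_j(\mu)=\{v\in\mathcal{X}\mid \exists w\in\mathcal{U}:\ (A-\mu I_n)v+Bw=0,\ C_{(j)}v+D_{(j)}w=0\}$. Tracking: for a constant reference $r\in\mathcal{Y}$ choose $x_{ss},u_{ss}$ with $0=Ax_{ss}+Bu_{ss}$ (continuous) or $x_{ss}=Ax_{ss}+Bu_{ss}$ (discrete), and $r=Cx_{ss}+Du_{ss}$. Under $u=F(x-x_{ss})+u_{ss}$, with $\xi=x-x_{ss}$,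 one has $\mathcal{D}\xi=(A+BF)\xi$ and the tracking error is $\epsilon=y-r=(C+DF)\xi$. Problem 3 (for given $\lambda_1,\ldots,\lambda_p\in\Lambda_g$): find a real feedback matrix $F$ such that $A+BF$ is asymptotically stable and, for all initial conditions and all step references $r$, $\epsilon(t)=[\beta_1e^{\lambda_1t},\ldots,\beta_pe^{\lambda_pt}]^\top$ (continuous) or $\epsilon(t)=[\beta_1\lambda_1^t,\ldots,\beta_p\lambda_p^t]^\top$ (discrete), for some real $\beta_k$ depending only on $\xi(0)$ (possibly zero). *)

(* Defs.v *)
From HB Require Import structures.
From mathcomp Require Import all_boot all_order all_algebra fraction complex.
From mathcomp Require Import all_classical all_reals all_analysis.

Set Implicit Arguments.
Unset Strict Implicit.
Unset Printing Implicit Defensive.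

Import Order.TTheory GRing.Theory Num.Theory.
Import numFieldNormedType.Exports.

Local Open Scope classical_set_scope.
Local Open Scope ring_scope.

Inductive time_domain := ContinuousTime | DiscreteTime.

Section Time.
Context (R : realType) (td : time_domain).

Definition Cgood : set R[i] :=
  if td is ContinuousTime then [set z | complex.Re z < 0] else [set z | `|z| < 1].

Definition Lgood : set R :=
  if td is ContinuousTime then [set l | l < 0] else [set l | 0 <= l < 1].

(* The value of the operator x |-> Dx on constant signals: x is an equilibrium
   of Dx = f x iff f x = steady_value *: x. *)
Definition steady_value : R := if td is ContinuousTime then 0 else 1.

End Time.

(* ContinuousTime-time signals are total functions on R; only their values at
   t >= 0 are ever constrained or used. *)
Definition time (R : realType) (td : time_domain) : Type :=
  if td is ContinuousTime then (R : Type) else nat.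

Definition time0 (R : realType) (td : time_domain) : time R td :=
  match td with ContinuousTime => 0 | DiscreteTime => 0%N end.

Definition nonneg_time (R : realType) (td : time_domain) : time R td -> Prop :=
  match td with ContinuousTime => fun t => 0 <= t | DiscreteTime => fun=> True end.

(* The scalar mode e^{l t}, resp. l^t; note 0 ^+ 0 = 1. *)
Definition mode (R : realType) (td : time_domain) (l : R) : time R td -> R :=
  match td with
  | ContinuousTime => fun t => expR (l * t)
  | DiscreteTime => fun t => l ^+ t
  end.

(* x solves Dx = f x on the nonnegative times. In continuous time this is the
   differential equation on t > 0 together with right-continuity at t = 0,
   which forces the one-sided derivative of x at 0 to be f (x 0) whenever f is
   continuous. *)
Definition solves (R : realType) (td : time_domain) (n : nat)
    (f : 'cV[R]_n -> 'cV[R]_n) : (time R td -> 'cV[R]_n) -> Prop :=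
  match td with
  | ContinuousTime => fun x : R -> 'cV[R]_n => forall i : 'I_n,
      (forall t : R, 0 < t -> is_derive t 1 (fun s => x s i 0) (f (x t) i 0))
      /\ x s i 0 @[s --> 0^'+] --> x 0 i 0
  | DiscreteTime => fun x : nat -> 'cV[R]_n => forall t, x t.+1 = f (x t)
  end.

Definition asymp_stable (R : realType) (td : time_domain) (n : nat)
    (M : 'M[R]_n) : Prop :=
  forall z : R[i], eigenvalue (map_mx (real_complex R) M) z -> Cgood td z.

(* The matrix, in the basis vbasis V, of the restriction to V of v |-> M *m v;
   meaningful when V is M-invariant. *)
Definition restr_mx (R : realType) (n : nat) (M : 'M[R]_n)
    (V : {vspace 'cV[R]_n}) : 'M[R]_(\dim V) :=
  \matrix_(i, j) coord (vbasis V) i (M *m (vbasis V)`_j).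

Section SmithForm.
Context (K : fieldType) (k l : nat).

(* The (unique) Smith form, with invariant polynomials normalised to be
   monic. *)
Definition is_smith_form (P S : 'M[{poly K}]_(k, l)) : Prop :=
  [/\ exists L : 'M[{poly K}]_k, exists U : 'M[{poly K}]_l,
        [/\ L \in unitmx, U \in unitmx & L *m P *m U = S],
      forall (i : 'I_k) (j : 'I_l), (i != j :> nat) -> S i j = 0,
      forall (i i' : 'I_k) (j j' : 'I_l), (i = j :> nat) -> (i' = j' :> nat) ->
        (i <= i')%N -> S i j %| S i' j'
    & forall i j, S i j != 0 -> S i j \is monic].

Definition smith_form (P : 'M[{poly K}]_(k, l)) : 'M[{poly K}]_(k, l) :=
  xget 0 [set S | is_smith_form P S].

Definition smith_product (P : 'M[{poly K}]_(k, l)) : {poly K} :=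
  \prod_(ij : 'I_k * 'I_l | smith_form P ij.1 ij.2 != 0)
    smith_form P ij.1 ij.2.

Definition normal_rank (P : 'M[{poly K}]_(k, l)) : nat :=
  \rank (map_mx (@tofrac _) P).

End SmithForm.

Section System.
Context (R : realType) (td : time_domain) (n m p : nat).
Context (A : 'M[R]_n) (B : 'M[R]_(n, m)) (C : 'M[R]_(p, n)) (D : 'M[R]_(p, m)).

Definition standing_assumptions : Prop :=
  row_free (col_mx B D)^T /\ row_free (row_mx C D).

Definition rosenbrock : 'M[{poly R}]_(n + p, n + m) :=
  block_mx (map_mx polyC A - 'X%:M) (map_mx polyC B)
           (map_mx polyC C) (map_mx polyC D).

Definition rosenbrock_at (z : R[i]) : 'M[R[i]]_(n + p, n + m) :=
  map_mx (fun q : {poly R} => (map_poly (real_complex R) q).[z]) rosenbrock.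

Definition invariant_zeros : set R[i] :=
  [set z | (\rank (rosenbrock_at z) < normal_rank rosenbrock)%N].

Definition zero_multiplicity (z : R[i]) : nat :=
  mup z (map_poly (real_complex R) (smith_product rosenbrock)).

Definition right_invertible : Prop :=
  finite_set [set z : R[i] | \rank (rosenbrock_at z) <> (n + p)%N].

Definition stabilisable : Prop :=
  exists F : 'M[R]_(m, n), asymp_stable td (A + B *m F).

Definition assumption1 : Prop :=
  [/\ right_invertible, stabilisable
    & ~ invariant_zeros (real_complex R (steady_value R td))].

Definition assumption2 : Prop :=
  forall z : R[i], invariant_zeros z -> Cgood td z -> zero_multiplicity z = 1%N.

Definition stable_output_nulling (V : {vspace 'cV[R]_n}) : Prop :=
  exists F : 'M[R]_(m, n),
    [/\ forall v, v \in V -> (A + B *m F) *m v \in V,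
        forall v, v \in V -> (C + D *m F) *m v = 0
      & asymp_stable td (restr_mx (A + B *m F) V)].

(* The largest such subspace always exists, so the default 0 of xget is
   immaterial. *)
Definition Vstar_g : {vspace 'cV[R]_n} :=
  xget 0%VS [set V | stable_output_nulling V /\
    forall W, stable_output_nulling W -> (W <= V)%VS].

(* The projection to the state component of the kernel of
   [A - mu I, B; C_(j), D_(j)]; see mem_Rstar. *)
Definition Rstar (j : 'I_p) (mu : R) : {vspace 'cV[R]_n} :=
  (linfun (usubmx : 'cV[R]_(n + m) -> 'cV[R]_n) @:
     lker (linfun (mulmx (block_mx (A - mu%:M) B (row' j C) (row' j D)) :
       'cV[R]_(n + m) -> 'cV[R]_(n + p.-1))))%VS.

Lemma mem_Rstar (j : 'I_p) (mu : R) (v : 'cV[R]_n) :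
  v \in Rstar j mu <->
  exists w : 'cV[R]_m, (A - mu%:M) *m v + B *m w = 0 /\
                       row' j C *m v + row' j D *m w = 0.
Proof.
split=> [/memv_imgP[x + ->]|[w [h1 h2]]].
  rewrite memv_ker !lfunE /= -[x]vsubmxK mul_block_col -col_mx0 => /eqP.
  by move=> /eq_col_mx[h1 h2]; exists (dsubmx x); rewrite col_mxKu.
apply/memv_imgP; exists (col_mx v w); last by rewrite lfunE /= col_mxKu.
by rewrite memv_ker lfunE /= mul_block_col h1 h2 col_mx0.
Qed.

Definition steady_state (r : 'cV[R]_p) (xss : 'cV[R]_n) (uss : 'cV[R]_m) :
    Prop :=
  A *m xss + B *m uss = steady_value R td *: xss /\ C *m xss + D *m uss = r.

Definition control (F : 'M[R]_(m, n)) (xss : 'cV[R]_n) (uss : 'cV[R]_m)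
    (x : 'cV[R]_n) : 'cV[R]_m := F *m (x - xss) + uss.

Definition problem3_solution (lambda : 'I_p -> R) (F : 'M[R]_(m, n)) : Prop :=
  asymp_stable td (A + B *m F) /\
  exists beta : 'cV[R]_n -> 'I_p -> R, forall r : 'cV[R]_p,
    (exists xss uss, steady_state r xss uss) /\
    forall xss uss, steady_state r xss uss ->
    forall x : time R td -> 'cV[R]_n,
      solves (fun v => A *m v + B *m control F xss uss v) x ->
    forall t, nonneg_time t -> forall k : 'I_p,
      (C *m x t + D *m control F xss uss (x t) - r) k 0
        = beta (x (time0 R td) - xss) k * mode (lambda k) t.

Definition problem3_solvable (lambda : 'I_p -> R) : Prop :=
  exists F : 'M[R]_(m, n), problem3_solution lambda F.

End System.

(* Main.v *)
Require Import Defs.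
From mathcomp Require Import all_boot all_order all_algebra fraction complex.
From mathcomp Require Import all_classical all_reals all_analysis.
From mathcomp Require Import ring zify.

(** Write [N = A + B F], [G = C + D F] and let [L] be the diagonal matrix of the
    prescribed modes. Tracking with one mode per output component means exactly
    that [N] is stable and [G N = L G]: the forward direction differentiates
    the error at time 0 ([decoupled_of_solution]), the converse is uniqueness for
    scalar linear equations ([solution_of_decoupled]).

    The other ingredient is maximality of Vg, the largest stable output-nulling
    subspace. It absorbs every vector [v] for which some input [w] gives
    [A v + B w = mu v] modulo Vg with zero output, for a good real [mu]
    ([Vstar_g_absorbs]), because otherwise [v] could be added to Vg as one more
    stable mode. As the system is right invertible at [lambda j], the subspace
    R_j attached to the j-th output is therefore at most a line modulo Vg
    ([Rstar_line_mod_Vstar]).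
    Hence omitting an index from the sum of the R_j lowers the dimension by at
    most one, and the whole family of dimension conditions is equivalent to the
    single condition that Vg and all the R_j together span the state space.

    This spanning condition is equivalent to the existence of [F]. If it holds, a
    stabilizing friend of Vg is extended by declaring vectors of R_j to be
    eigenvectors for [lambda j] with output along the j-th axis
    ([decoupling_exists]). Conversely, given [F], the kernel of [G] is stable and
    output-nulling, hence in Vg, and the quotient of the state space by this
    kernel embeds through [G] in a space where [L] is diagonal; splitting a state
    along the eigenspaces of [L] writes it as a sum of elements of Vg and of the
    R_j ([decoupled_span]).

    Existence of Vg ([Vstar_gP]) is itself a small step argument: if an
    output-nulling subspace W is not contained in V, then some closed-loop
    eigenvalue of W has an eigenvector modulo V lying in W but not in V, and
    adding its real and imaginary parts to V gives a larger one. *)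

Set Implicit Arguments.
Unset Strict Implicit.
Unset Printing Implicit Defensive.

Import Order.TTheory GRing.Theory Num.Theory.
Import numFieldNormedType.Exports.

Local Open Scope ring_scope.

(** * Complex vectors over real subspaces *)

Section ComplexVectors.
Context (R : realType).

(** Complex matrices are handled through their real and imaginary parts, so that
    real subspaces can be complexified without changing the base field. *)
Definition re_mx k l (x : 'M[R[i]]_(k, l)) : 'M[R]_(k, l) :=
  map_mx (@complex.Re R) x.
Definition im_mx k l (x : 'M[R[i]]_(k, l)) : 'M[R]_(k, l) :=
  map_mx (@complex.Im R) x.
Definition cplx_mx k l (x : 'M[R]_(k, l)) : 'M[R[i]]_(k, l) :=
  map_mx (real_complex R) x.

Lemma complex_ReD (x y : R[i]) : complex.Re (x + y) = complex.Re x + complex.Re y.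
Proof. by case: x y => [a b] [c d]. Qed.

Lemma complex_ImD (x y : R[i]) : complex.Im (x + y) = complex.Im x + complex.Im y.
Proof. by case: x y => [a b] [c d]. Qed.

Lemma complex_ReM (x y : R[i]) :
  complex.Re (x * y) = complex.Re x * complex.Re y - complex.Im x * complex.Im y.
Proof. by case: x y => [a b] [c d]. Qed.

Lemma complex_ImM (x y : R[i]) :
  complex.Im (x * y) = complex.Re x * complex.Im y + complex.Im x * complex.Re y.
Proof. by case: x y => [a b] [c d]. Qed.

Lemma Re_sum (I : finType) (f : I -> R[i]) :
  complex.Re (\sum_i f i) = \sum_i complex.Re (f i).
Proof. exact: (big_morph _ complex_ReD erefl). Qed.

Lemma Im_sum (I : finType) (f : I -> R[i]) :
  complex.Im (\sum_i f i) = \sum_i complex.Im (f i).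
Proof. exact: (big_morph _ complex_ImD erefl). Qed.

Lemma re_mxD k l (x y : 'M[R[i]]_(k, l)) : re_mx (x + y) = re_mx x + re_mx y.
Proof. by apply/matrixP => i j; rewrite !mxE complex_ReD. Qed.

Lemma im_mxD k l (x y : 'M[R[i]]_(k, l)) : im_mx (x + y) = im_mx x + im_mx y.
Proof. by apply/matrixP => i j; rewrite !mxE complex_ImD. Qed.

Lemma re_mxB k l (x y : 'M[R[i]]_(k, l)) : re_mx (x - y) = re_mx x - re_mx y.
Proof. by apply/matrixP => i j; rewrite !mxE; case: (x i j) (y i j) => ? ? []. Qed.

Lemma im_mxB k l (x y : 'M[R[i]]_(k, l)) : im_mx (x - y) = im_mx x - im_mx y.
Proof. by apply/matrixP => i j; rewrite !mxE; case: (x i j) (y i j) => ? ? []. Qed.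

Lemma re_mxZ k l z (x : 'M[R[i]]_(k, l)) :
  re_mx (z *: x) = complex.Re z *: re_mx x - complex.Im z *: im_mx x.
Proof. by apply/matrixP => i j; rewrite !mxE complex_ReM. Qed.

Lemma im_mxZ k l z (x : 'M[R[i]]_(k, l)) :
  im_mx (z *: x) = complex.Re z *: im_mx x + complex.Im z *: re_mx x.
Proof. by apply/matrixP => i j; rewrite !mxE complex_ImM. Qed.

Lemma re_mxM k l q (N : 'M[R]_(k, l)) (x : 'M[R[i]]_(l, q)) :
  re_mx (cplx_mx N *m x) = N *m re_mx x.
Proof.
apply/matrixP => i j; rewrite !mxE Re_sum; apply: eq_bigr => h _.
by rewrite !mxE complex_ReM /= mul0r subr0.
Qed.

Lemma im_mxM k l q (N : 'M[R]_(k, l)) (x : 'M[R[i]]_(l, q)) :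
  im_mx (cplx_mx N *m x) = N *m im_mx x.
Proof.
apply/matrixP => i j; rewrite !mxE Im_sum; apply: eq_bigr => h _.
by rewrite !mxE complex_ImM /= mul0r addr0.
Qed.

Lemma re_cplx k l (x : 'M[R]_(k, l)) : re_mx (cplx_mx x) = x.
Proof. by apply/matrixP => i j; rewrite !mxE. Qed.

Lemma im_cplx k l (x : 'M[R]_(k, l)) : im_mx (cplx_mx x) = 0.
Proof. by apply/matrixP => i j; rewrite !mxE. Qed.

Lemma cplx_mx_split k l (x : 'M[R[i]]_(k, l)) :
  x = cplx_mx (re_mx x) + 'i%C *: cplx_mx (im_mx x).
Proof. by apply/matrixP => i j; rewrite !mxE [LHS]complexE. Qed.

Lemma cplx_mx0 k l : cplx_mx (0 : 'M[R]_(k, l)) = 0.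
Proof. exact: map_mx0. Qed.

Lemma cplx_eqP k l (x y : 'M[R[i]]_(k, l)) :
  re_mx x = re_mx y -> im_mx x = im_mx y -> x = y.
Proof. by move=> re im; rewrite [x]cplx_mx_split re im -cplx_mx_split. Qed.

Section CMem.
Context (n : nat).
Implicit Types (V W E : {vspace 'cV[R]_n}) (x y : 'cV[R[i]]_n) (z : R[i]).

(** Membership in the complexification of the real subspace [V]. *)
Definition cmem V x : bool := (re_mx x \in V) && (im_mx x \in V).

Lemma cmem0 V : cmem V 0.
Proof.
by rewrite -cplx_mx0 /cmem re_cplx im_cplx mem0v.
Qed.

Lemma cmemD V x y : cmem V x -> cmem V y -> cmem V (x + y).
Proof. by case/andP=> a b /andP[c d]; rewrite /cmem re_mxD im_mxD !memvD. Qed.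

Lemma cmemZ V z x : cmem V x -> cmem V (z *: x).
Proof.
case/andP=> a b; rewrite /cmem re_mxZ im_mxZ.
by rewrite memvB ?memvZ// memvD ?memvZ.
Qed.

Lemma cmemN V x : cmem V x -> cmem V (- x).
Proof. by move=> /(cmemZ (-1)); rewrite scaleN1r. Qed.

Lemma cmemB V x y : cmem V x -> cmem V y -> cmem V (x - y).
Proof. by move=> Vx Vy; rewrite cmemD// cmemN. Qed.

Lemma cmem_cplx V v : cmem V (cplx_mx v) = (v \in V).
Proof. by rewrite /cmem re_cplx im_cplx mem0v andbT. Qed.

Lemma cmemM V N x : (forall v, v \in V -> N *m v \in V) ->
  cmem V x -> cmem V (cplx_mx N *m x).
Proof. by move=> NV /andP[a b]; rewrite /cmem re_mxM im_mxM !NV. Qed.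

Lemma cmem_addP V W x :
  cmem (V + W) x -> exists y1 y2, [/\ cmem V y1, cmem W y2 & x = y1 + y2].
Proof.
case/andP=> /memv_addP[a Va [b Wb ab]] /memv_addP[c Vc [d Wd cd]].
exists (cplx_mx a + 'i%C *: cplx_mx c), (cplx_mx b + 'i%C *: cplx_mx d).
split; try by apply: cmemD; rewrite ?cmemZ// cmem_cplx.
rewrite [x]cplx_mx_split ab cd /cplx_mx !map_mxD scalerDr.
by rewrite -!addrA; congr (_ + _); rewrite addrCA.
Qed.

Lemma cmem_lineP (a : 'cV[R]_n) x :
  cmem <[a]> x -> exists c, x = c *: cplx_mx a.
Proof.
case/andP=> /vlineP[k ak] /vlineP[l al]; exists (k +i* l)%C.
apply/matrixP => i j; have := congr1 (fun w : 'cV[R]_n => w i j) ak.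
have := congr1 (fun w : 'cV[R]_n => w i j) al.
rewrite !mxE; case: (x i j) => p q /= -> ->.
by apply/eqP; rewrite eq_complex /= !mulr0 subr0 add0r !eqxx.
Qed.

End CMem.

(** The library speaks of row eigenvectors, whereas states are columns. *)
Lemma eigenvalue_colP (F : fieldType) n (M : 'M[F]_n) z :
  reflect (exists2 x : 'cV[F]_n, M *m x = z *: x & x != 0) (eigenvalue M z).
Proof.
have -> : eigenvalue M z = eigenvalue M^T z.
  rewrite /eigenvalue /eigenspace !kermx_eq0 -!row_leq_rank -[X in _ = ~~ (_ <= X)%N]mxrank_tr.
  by rewrite linearB /= trmxK tr_scalar_mx.
apply: (iffP eigenvalueP) => [[v Mv v0]|[x Mx x0]].
  exists v^T; last by rewrite -(inj_eq (can_inj (@trmxK _ _ _))) trmxK trmx0.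
  by rewrite -[M]trmxK -trmx_mul Mv linearZ.
exists x^T; last by rewrite -(inj_eq (can_inj (@trmxK _ _ _))) trmxK trmx0.
by rewrite -trmx_mul Mx linearZ.
Qed.

Section BasisMatrix.
Context (n : nat).
Implicit Types (V : {vspace 'cV[R]_n}).

Definition basis_mx V : 'M[R]_(n, \dim V) := \matrix_(i, j) (vbasis V)`_j i 0.

Lemma basis_mxE V (c : 'cV_(\dim V)) : basis_mx V *m c = \sum_j c j 0 *: (vbasis V)`_j.
Proof.
apply/matrixP => i j; rewrite !mxE summxE; apply: eq_bigr => h _.
by rewrite !mxE !ord1 mulrC.
Qed.

Lemma basis_mx_mem V (c : 'cV_(\dim V)) : basis_mx V *m c \in V.
Proof.
rewrite basis_mxE; apply: memv_suml => j _; apply: memvZ.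
by apply: vbasis_mem; apply: mem_nth; rewrite size_tuple.
Qed.

Lemma basis_mx_coord V v : v \in V ->
  v = basis_mx V *m (\col_j coord (vbasis V) j v).
Proof.
move=> Vv; rewrite basis_mxE [LHS](coord_vbasis Vv).
by apply: eq_bigr => j _; rewrite !mxE.
Qed.

Lemma basis_mx_inj V (c : 'cV_(\dim V)) : basis_mx V *m c = 0 -> c = 0.
Proof.
rewrite basis_mxE => c0; apply/matrixP => j k; rewrite ord1 mxE.
by have /freeP/(_ (fun j => c j 0) c0 j) := basis_free (vbasisP V).
Qed.

Lemma restr_mxP V M : (forall v, v \in V -> M *m v \in V) ->
  M *m basis_mx V = basis_mx V *m restr_mx M V.
Proof.
move=> MV; apply/matrixP => i j.
have colj (N : 'M[R]_(n, \dim V)) : N i j = (N *m delta_mx j 0 : 'cV_n) i 0.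
  by rewrite -colE mxE.
rewrite !colj.
have Ej : basis_mx V *m delta_mx j 0 = (vbasis V)`_j.
  by rewrite -colE; apply/matrixP => k l; rewrite !mxE ord1.
rewrite -!mulmxA Ej.
have Vj : (vbasis V)`_j \in V by apply: vbasis_mem; apply: mem_nth; rewrite size_tuple.
rewrite [M *m _](basis_mx_coord (MV _ Vj)); congr ((_ *m _) _ _).
by apply/matrixP => k l; rewrite -colE !mxE.
Qed.
End BasisMatrix.
End ComplexVectors.

(** * Stability on invariant subspaces *)

Section Stability.
Context (R : realType) (td : time_domain).

(** Stability of the restriction of [N] to [V], phrased without choosing a basis
    of [V]; for an invariant subspace it is the stability of the matrix of the
    restriction, by [asymp_stable_restr]. *)
Definition stable_on n (N : 'M[R]_n) (V : {vspace 'cV[R]_n}) : Prop :=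
  forall (x : 'cV[R[i]]_n) z, x != 0 -> cmem V x ->
    cplx_mx N *m x = z *: x -> Cgood td z.

Lemma asymp_stableP n (N : 'M[R]_n) :
  asymp_stable td N <-> stable_on N fullv.
Proof.
split=> [sN x z x0 _ Nx|sN z /eigenvalue_colP[x Nx x0]].
  by apply: sN; apply/eigenvalue_colP; exists x.
by apply: sN x0 _ Nx; rewrite /cmem !memvf.
Qed.

Lemma cmem_basisP n (V : {vspace 'cV[R]_n}) x :
  cmem V x -> exists c, x = cplx_mx (basis_mx V) *m c.
Proof.
case/andP=> /basis_mx_coord re /basis_mx_coord im.
move: (\col_ _ _) re (\col_ _ _) im => c re d im.
exists (cplx_mx c + 'i%C *: cplx_mx d).
by rewrite [LHS]cplx_mx_split re im /cplx_mx !map_mxM mulmxDr -scalemxAr.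
Qed.

Lemma basis_cmem n (V : {vspace 'cV[R]_n}) (c : 'cV_(\dim V)) :
  cmem V (cplx_mx (basis_mx V) *m c).
Proof. by rewrite /cmem re_mxM im_mxM !basis_mx_mem. Qed.

Lemma basis_cplx_inj n (V : {vspace 'cV[R]_n}) (c : 'cV_(\dim V)) :
  cplx_mx (basis_mx V) *m c = 0 -> c = 0.
Proof.
move=> c0; rewrite [c]cplx_mx_split.
have /basis_mx_inj -> : basis_mx V *m re_mx c = 0.
  by rewrite -re_mxM c0 -cplx_mx0 re_cplx.
have /basis_mx_inj -> : basis_mx V *m im_mx c = 0.
  by rewrite -im_mxM c0 -cplx_mx0 im_cplx.
by rewrite cplx_mx0 scaler0 addr0.
Qed.

Lemma restr_cplx n (N : 'M[R]_n) V (c : 'cV_(\dim V)) :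
  (forall v, v \in V -> N *m v \in V) ->
  cplx_mx N *m (cplx_mx (basis_mx V) *m c) =
  cplx_mx (basis_mx V) *m (cplx_mx (restr_mx N V) *m c).
Proof. by move=> /restr_mxP NV; rewrite !mulmxA /cplx_mx -!map_mxM NV. Qed.

Lemma asymp_stable_restr n (N : 'M[R]_n) (V : {vspace 'cV[R]_n}) :
  (forall v, v \in V -> N *m v \in V) ->
  asymp_stable td (restr_mx N V) <-> stable_on N V.
Proof.
move=> NV; split=> [sN x z x0 /cmem_basisP[c xc] Nx|sN z /eigenvalue_colP[c Nc c0]].
  apply: sN; apply/eigenvalue_colP; exists c; last first.
    by apply: contra_neq x0; rewrite xc => ->; rewrite mulmx0.
  apply/eqP; rewrite -subr_eq0; apply/eqP/(@basis_cplx_inj _ V).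
  by rewrite mulmxBr -scalemxAr -restr_cplx// -xc Nx subrr.
apply: (sN _ z) (basis_cmem c) _.
  by apply: contra_neq c0; apply: basis_cplx_inj.
by rewrite restr_cplx// [cplx_mx _ *m c]Nc -scalemxAr.
Qed.

(** The spectrum of [N] on [V + E] is its spectrum on [V] together with that of
    the map induced on the quotient by [V]: an eigenvector of the sum either
    lies in [V] or has a nonzero [E]-component, which is then an eigenvector
    modulo [V]. Stating the second condition modulo [V] keeps the
    quotient space out of the argument. *)
Lemma stable_extension n (N : 'M[R]_n) (V E : {vspace 'cV[R]_n}) :
  (forall v, v \in V -> N *m v \in V) -> stable_on N V ->
  (forall e z, cmem E e -> cmem V (cplx_mx N *m e - z *: e) ->
     e = 0 \/ Cgood td z) ->
  stable_on N (V + E).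
Proof.
move=> NV sNV quot x z x0 /cmem_addP[y [e [Vy Ee xE]]] Nx.
have [|e0|//] := quot e z Ee.
  have -> : e = x - y by rewrite xE addrC addKr.
  rewrite mulmxBr Nx scalerBr opprB addrC addrA subrK.
  by apply: cmemB; [exact: cmemZ | exact: cmemM].
by apply: sNV x0 _ Nx; rewrite xE e0 addr0.
Qed.

Lemma cmem_lineI n (V : {vspace 'cV[R]_n}) a c :
  a \notin V -> cmem V (c *: cplx_mx a) -> c = 0.
Proof.
move=> aV /andP[]; rewrite re_mxZ im_mxZ re_cplx im_cplx !scaler0 subr0 add0r.
have eq0 k : k *: a \in V -> k = 0.
  move=> ka; apply: contraNeq aV => k0.
  by rewrite -[a](scalerK k0) memvZ.
by case: c => p q /= /eq0-> /eq0->.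
Qed.

(** Compose the difference of the two feedbacks with the projection onto [E]
    along [V]. *)
Lemma glue_feedback n m (V E : {vspace 'cV[R]_n}) (F1 F2 : 'M[R]_(m, n)) :
  (V :&: E = 0)%VS ->
  exists F : 'M[R]_(m, n), (forall v, v \in V -> F *m v = F1 *m v) /\
    (forall e, e \in E -> F *m e = F2 *m e).
Proof.
move=> VE.
pose P := (lin1_mx (trmx \o daddv_pi E V \o trmx))^T : 'M[R]_n.
have PE v : P *m v = daddv_pi E V v.
  by rewrite -[v in LHS]trmxK -trmx_mul mul_rV_lin1 /= !trmxK.
have EV : (E :&: V = 0)%VS by rewrite capvC.
exists (F1 + (F2 - F1) *m P); split=> v vV; rewrite mulmxDl -mulmxA PE.
  have -> : daddv_pi E V v = 0; last by rewrite mulmx0 addr0.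
  have := daddv_pi_add EV (subvP (addvSr E V) _ vV).
  by rewrite (daddv_pi_id VE vV) => /(canRL (addrK _)); rewrite subrr.
by rewrite (daddv_pi_id EV vV) mulmxBl addrC subrK.
Qed.

(** The predicate [U] need not be invariant under [M], so there is no induced map
    whose eigenvectors could be taken. Instead, by Cayley-Hamilton, the product
    of the factors [M - z], over the eigenvalues [z], kills [x]; applied one at a
    time, one of them is the first to bring the vector into [U]. *)
Lemma quotient_eigenvector (F : closedFieldType) d (M : 'M[F]_d)
    (U : 'cV[F]_d -> Prop) (x : 'cV[F]_d) : U 0 -> ~ U x ->
  exists z v, [/\ eigenvalue M z, ~ U v & U (M *m v - z *: v)].
Proof.
case: d M U x => [|d] M U x U0 Ux; first by case: Ux; rewrite flatmx0 -(flatmx0 0).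
have [rs] := closed_field_poly_normal (char_poly M).
rewrite (monicP (char_poly_monic M)) scale1r => charE.
have rsP z : z \in rs -> eigenvalue M z.
  by rewrite eigenvalue_root_char charE root_prod_XsubC.
have : U ((\prod_(z <- rs) (M - z%:M)) *m x).
  suff -> : \prod_(z <- rs) (M - z%:M) = 0 by rewrite mul0mx.
  rewrite -(Cayley_Hamilton M) charE rmorph_prod; apply: eq_bigr => z _.
  by rewrite rmorphB /= horner_mx_X horner_mx_C.
elim: rs rsP {charE} => [|z rs IH] rsP; first by rewrite big_nil mul1mx.
rewrite big_cons -mulmxE -mulmxA; set y := _ *m x => Uy.
have [/IH|nUy] := pselect (U y).
  by apply=> w wrs; apply: rsP; rewrite inE wrs orbT.
exists z, y; split=> //; first by apply: rsP; rewrite mem_head.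
by rewrite -mul_scalar_mx -mulmxBl.
Qed.
End Stability.

(** * Extending stable feedbacks by modes *)

Section Extension.
Context (R : realType) (td : time_domain) (n m : nat).
Context (A : 'M[R]_n) (B : 'M[R]_(n, m)).
Implicit Types (V W E : {vspace 'cV[R]_n}) (F : 'M[R]_(m, n)).

Definition stably_invariant F V : Prop :=
  (forall v, v \in V -> (A + B *m F) *m v \in V) /\ stable_on td (A + B *m F) V.

(** Feedbacks may be prescribed independently on complementary subspaces, and
    stability of the sum only depends on the second one modulo the first
    subspace. *)
Lemma extend_feedback V E F1 F2 :
  stably_invariant F1 V -> (V :&: E = 0)%VS ->
  (forall e, e \in E -> (A + B *m F2) *m e \in (V + E)%VS) ->
  (forall e z, cmem E e -> cmem V (cplx_mx (A + B *m F2) *m e - z *: e) ->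
     e = 0 \/ Cgood td z) ->
  exists F, [/\ forall v, v \in V -> F *m v = F1 *m v,
    forall e, e \in E -> F *m e = F2 *m e & stably_invariant F (V + E)].
Proof.
move=> [invV stV] VE invE stE; have [F [FV FE]] := glue_feedback F1 F2 VE.
have NV v : v \in V -> (A + B *m F) *m v = (A + B *m F1) *m v.
  by move=> vV; rewrite !mulmxDl -!mulmxA FV.
have NE v : v \in E -> (A + B *m F) *m v = (A + B *m F2) *m v.
  by move=> vV; rewrite !mulmxDl -!mulmxA FE.
exists F; split=> //; split.
  move=> _ /memv_addP[v vV [e eE ->]]; rewrite mulmxDr NV// NE//.
  by rewrite memvD ?invE// (subvP (addvSl _ _)) ?invV.
apply: stable_extension => [v vV|x z x0 xV Nx|e z eE Ne].
- by rewrite NV ?invV.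
- apply: (stV _ _ x0 xV); rewrite -Nx; case/andP: xV => re im.
  by apply: cplx_eqP; rewrite ?re_mxM ?im_mxM NV.
- apply: (stE e z eE); suff <- : cplx_mx (A + B *m F) *m e = cplx_mx (A + B *m F2) *m e.
    by [].
  by case/andP: eE => re im; apply: cplx_eqP; rewrite ?re_mxM ?im_mxM NE.
Qed.

Lemma capv_line V a : a \notin V -> (V :&: <[a]> = 0)%VS.
Proof.
move=> aV; apply/eqP; rewrite -subv0; apply/subvP => v /memv_capP[vV /vlineP[k vk]].
rewrite memv0 vk; have [->|k0] := eqVneq k 0; first by rewrite scale0r.
by case/negP: aV; rewrite -[a](scalerK k0) -vk memvZ.
Qed.

Lemma matrix_through (a : 'cV[R]_n) (w : 'cV[R]_m) :
  a != 0 -> exists F, F *m a = w.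
Proof.
move=> /matrix0Pn[i [j ai]]; rewrite ord1 in ai.
exists (w *m ((a i 0)^-1 *: delta_mx 0 i)); rewrite -mulmxA -scalemxAl -rowE.
have -> : row i a = (a i 0)%:M by apply/matrixP => k l; rewrite !ord1 !mxE.
by rewrite scale_scalar_mx mulVf// mulmx1.
Qed.

(** One real mode: [a] becomes, modulo [V], an eigenvector for [s]. *)
Lemma extend_line V F1 a w s :
  stably_invariant F1 V -> a \notin V -> A *m a + B *m w - s *: a \in V ->
  Cgood td (real_complex R s) ->
  exists F, [/\ forall v, v \in V -> F *m v = F1 *m v, F *m a = w
    & stably_invariant F (V + <[a]>)].
Proof.
move=> inv1 aV aw sg.
have a0 : a != 0 by apply: contraNneq aV => ->; rewrite mem0v.
have [F2 F2a] := matrix_through w a0.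
have Na : (A + B *m F2) *m a = (A *m a + B *m w - s *: a) + s *: a.
  by rewrite subrK mulmxDl -mulmxA F2a.
have [||F [FV FE invF]] := extend_feedback (F2 := F2) inv1 (capv_line aV).
- move=> _ /vlineP[k ->]; rewrite -scalemxAr memvZ// Na.
  by rewrite memv_add// memvZ// memv_line.
- move=> e z /cmem_lineP[c ->].
  have -> : cplx_mx (A + B *m F2) *m (c *: cplx_mx a) - z *: (c *: cplx_mx a) =
      c *: cplx_mx (A *m a + B *m w - s *: a)
      + (c * (real_complex R s - z)) *: cplx_mx a.
    rewrite -scalemxAr /cplx_mx -map_mxM Na map_mxD scalerDr -addrA.
    congr (_ + _); rewrite map_mxZ !scalerA mulrBr scalerBl; congr (_ - _ *: _).
    by rewrite mulrC.
  move=> H; have : cmem V ((c * (real_complex R s - z)) *: cplx_mx a).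
    rewrite -[X in cmem V X](addKr (c *: cplx_mx (A *m a + B *m w - s *: a))).
    by rewrite addrC cmemB// cmemZ// cmem_cplx.
  move=> /(cmem_lineI aV)/eqP; rewrite mulf_eq0 subr_eq0 => /orP[/eqP->|/eqP<-].
    by left; rewrite scale0r.
  by right.
- by exists F; split=> //; rewrite FE ?memv_line.
Qed.

(** Both stability regions are symmetric under conjugation and convex. *)
Lemma Cgood_Re (z : R[i]) : Cgood td z -> Cgood td (real_complex R (complex.Re z)).
Proof.
case: td => //=; apply: le_lt_trans; apply: le_trans (normc_ge_Re z).
by rewrite normc_def /= expr0n addr0 sqrtr_sqr.
Qed.

(** One complex mode. If the real and imaginary parts of [v] are independent
    modulo [V], both are added and the quotient map has eigenvalues [z] and its
    conjugate. Otherwise a complex multiple of [v] is real modulo [V]; then that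
    real vector alone is added, with eigenvalue the real part of [z]. *)
Lemma extend_pair V F1 F2 (v : 'cV[R[i]]_n) z :
  stably_invariant F1 V -> ~~ cmem V v ->
  cmem V (cplx_mx (A + B *m F2) *m v - z *: v) -> Cgood td z ->
  exists F E, [/\ forall v, v \in V -> F *m v = F1 *m v, ~~ (E <= V)%VS,
    (E <= <[re_mx v]> + <[im_mx v]>)%VS, forall e, e \in E -> F *m e = F2 *m e
    & stably_invariant F (V + E)].
Proof.
move=> inv1 vV; set T := A + B *m F2 => Tv zg.
have [[c [c0 cv]]|indep] := pselect (exists c : R[i], c != 0 /\ im_mx (c *: v) \in V).
  (* [im_mx u] is in [V], so [u] is congruent to the real vector [a]. *)
  pose u := c *: v; pose a := re_mx u.
  have uE : cmem V (cplx_mx T *m u - z *: u).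
    by rewrite -scalemxAr scalerA mulrC -scalerA -scalerBr cmemZ.
  have aV : a \notin V.
    apply: contra vV => aV; rewrite -[v](scalerK c0) cmemZ//.
    by rewrite /cmem aV.
  have Ta : A *m a + B *m (F2 *m a) - complex.Re z *: a \in V.
    move: uE => /andP[+ _]; rewrite re_mxB re_mxZ re_mxM mulmxDl -mulmxA -/a => H.
    suff -> : A *m a + B *m (F2 *m a) - complex.Re z *: a =
      A *m a + B *m (F2 *m a)
        - (complex.Re z *: a - complex.Im z *: im_mx u)
        - complex.Im z *: im_mx u by rewrite memvB// memvZ.
    by rewrite opprB addrA [in RHS]addrAC addrK.
  have [F [FV Fa Finv]] := extend_line inv1 aV Ta (Cgood_Re zg).
  exists F, <[a]>%VS; split=> //.
  - rewrite -memvE /a re_mxZ; apply: memv_add; first by rewrite memvZ ?memv_line.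
    by rewrite -scaleNr memvZ ?memv_line.
  - by move=> _ /vlineP[k ->]; rewrite -!scalemxAr Fa.
pose a := re_mx v; pose b := im_mx v; pose E := (<[a]> + <[b]>)%VS.
have {}indep (k l : R) : k *: a + l *: b \in V -> k = 0 /\ l = 0.
  move=> kl; have [kl0|kl0] := eqVneq (l +i* k)%C 0; first by case: kl0.
  case: indep; exists (l +i* k)%C; split=> //.
  by rewrite im_mxZ /= addrC.
have indepC (k l : R[i]) : cmem V (k *: cplx_mx a + l *: cplx_mx b) -> k = 0 /\ l = 0.
  case/andP; rewrite re_mxD im_mxD !re_mxZ !im_mxZ !re_cplx !im_cplx !scaler0.
  rewrite !subr0 !add0r; case: k l => [p q] [r s] /= /indep[-> ->] /indep[-> ->].
  by [].
have VE : (V :&: E = 0)%VS.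
  apply/eqP; rewrite -subv0; apply/subvP => e /memv_capP[eV].
  case/memv_addP => _ /vlineP[k ->] [_ /vlineP[l ->] ekl].
  by move: eV; rewrite ekl => /indep[-> ->]; rewrite !scale0r addr0 mem0v.
have [ta tb] : T *m a - (complex.Re z *: a - complex.Im z *: b) \in V /\
    T *m b - (complex.Re z *: b + complex.Im z *: a) \in V.
  by move: Tv; rewrite /cmem re_mxB im_mxB re_mxM im_mxM re_mxZ im_mxZ => /andP.
have [aE bE] : a \in E /\ b \in E.
  by split; rewrite /E; [apply: (subvP (addvSl _ _))|apply: (subvP (addvSr _ _))];
    rewrite memv_line.
have [||F [FV FE invF]] := extend_feedback (F2 := F2) inv1 VE.
- move=> _ /memv_addP[_ /vlineP[k ->] [_ /vlineP[l ->] ->]].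
  rewrite mulmxDr -!scalemxAr -/T.
  rewrite -[T *m b](subrK (complex.Re z *: b + complex.Im z *: a)).
  rewrite -[T *m a](subrK (complex.Re z *: a - complex.Im z *: b)).
  by rewrite memvD// memvZ// memv_add// ?memvB ?memvD ?memvZ.
- move=> e w /cmem_addP[_ [_ [/cmem_lineP[k ->] /cmem_lineP[l ->] ->]]].
  set x := _ - _ => xV.
  pose s := real_complex R (complex.Re z); pose t := real_complex R (complex.Im z).
  have : cmem V ((k * (s - w) + l * t) *: cplx_mx a
                 + (l * (s - w) - k * t) *: cplx_mx b).
    have -> : (k * (s - w) + l * t) *: cplx_mx a
                 + (l * (s - w) - k * t) *: cplx_mx b =
        x - k *: cplx_mx (T *m a - (complex.Re z *: a - complex.Im z *: b))
          - l *: cplx_mx (T *m b - (complex.Re z *: b + complex.Im z *: a)).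
      rewrite /x -/T; apply/matrixP => i j.
      rewrite /cplx_mx !(map_mxD, map_mxB, map_mxZ, map_mxM) mulmxDr -!scalemxAr.
      by rewrite !mxE -/s -/t; ring.
    apply: cmemB; last by apply: cmemZ; rewrite cmem_cplx.
    by apply: cmemB; [exact: xV | apply: cmemZ; rewrite cmem_cplx].
  move=> /indepC[h1 h2].
  (* The coefficient matrix of the system h1, h2 in k, l has determinant
     (s - w)^2 + t^2, whose roots w are z and its conjugate. *)
  have hk : k * ((s - w) ^+ 2 + t ^+ 2) = 0.
    rewrite (_ : _ * _ = (k * (s - w) + l * t) * (s - w)
       - (l * (s - w) - k * t) * t); last by ring.
    by rewrite h1 h2 !mul0r subr0.
  have hl : l * ((s - w) ^+ 2 + t ^+ 2) = 0.
    rewrite (_ : _ * _ = (k * (s - w) + l * t) * t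
       + (l * (s - w) - k * t) * (s - w)); last by ring.
    by rewrite h1 h2 !mul0r addr0.
  have [w0|w0] := eqVneq ((s - w) ^+ 2 + t ^+ 2) 0; last first.
    move/eqP: hk; move/eqP: hl; rewrite !mulf_eq0 (negPf w0) !orbF.
    by move=> /eqP-> /eqP->; left; rewrite !scale0r addr0.
  right; move: w0; rewrite (_ : _ + _ = (s + 'i%C * t - w) * (s - 'i%C * t - w)).
    move/eqP; rewrite mulf_eq0 !subr_eq0 => /orP[]/eqP <-.
      by rewrite /s /t -complexE.
    rewrite (_ : s - 'i%C * t = z^*%C); last first.
      by rewrite /s /t; case: (z) => p q /=; simpc.
    move: zg; case: (z) => p q; case: td => //=.
    by rewrite !normc_def /= sqrrN.
  have i2 : 'i%C ^+ 2 = -1 :> R[i] by exact: sqr_i.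
  by rewrite (_ : (_ - _) * _ = (s - w) ^+ 2 - 'i%C ^+ 2 * t ^+ 2); [rewrite i2; ring|ring].
exists F, E; split=> //; apply: contra vV => /subvP EV.
by rewrite /cmem !EV.
Qed.
End Extension.

(** * The largest stable output-nulling subspace *)

Section LargestSubspace.
Local Open Scope classical_set_scope.
Context (R : realType) (td : time_domain) (n m p : nat).
Context (A : 'M[R]_n) (B : 'M[R]_(n, m)) (C : 'M[R]_(p, n)) (D : 'M[R]_(p, m)).
Implicit Types (V W E : {vspace 'cV[R]_n}) (F : 'M[R]_(m, n)).

Local Notation nulling := (stable_output_nulling td A B C D).
Local Notation Vg := (Vstar_g td A B C D).

Lemma nullingP V : nulling V <->
  exists F, stably_invariant td A B F V /\
    forall v, v \in V -> (C + D *m F) *m v = 0.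
Proof.
split=> [[F [inv null st]]|[F [[inv st] null]]]; exists F.
  by split=> //; split=> //; apply/asymp_stable_restr.
by split=> //; apply/asymp_stable_restr.
Qed.

Lemma dim_cV : \dim {:'cV[R]_n} = n.
Proof. by rewrite dimvf /dim /= muln1. Qed.

(** The sum of two stabilizable output-nulling subspaces has a stabilizing friend
    too, but it is not obtained by gluing friends, since the spectrum modulo [V]
    is not controlled by the friend of [W]. It is enough to enlarge [V] a little:
    some eigenvalue of the closed loop on [W] has a vector of [W] outside [V] that
    is an eigenvector modulo [V], and [extend_pair] adds it. *)
Lemma nulling_enlarge V W : nulling V -> nulling W -> ~~ (W <= V)%VS ->
  exists V', [/\ nulling V', (V <= V')%VS & ~~ (V' <= V)%VS].
Proof.
move=> /nullingP[F1 [inv1 null1]] /nullingP[F2 [[inv2 st2] null2]].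
move=> /subvPn[x xW xV].
pose U c := cmem V (cplx_mx (basis_mx W) *m c) : Prop.
have [||z [c [zM cU]]] := quotient_eigenvector
    (cplx_mx (restr_mx (A + B *m F2) W)) (U := U)
    (x := cplx_mx (\col_j coord (vbasis W) j x)).
- by rewrite /U mulmx0 cmem0.
- by rewrite /U /cplx_mx -map_mxM -basis_mx_coord// [cmem _ _]cmem_cplx; apply/negP.
set v := cplx_mx (basis_mx W) *m c in cU *.
have vW : cmem W v by exact: basis_cmem.
rewrite /U mulmxBr -scalemxAr -restr_cplx// -/v => Tv.
have zg : Cgood td z by move/asymp_stable_restr: st2 => /(_ inv2); apply.
have [F [E [FV EV EW FE invF]]] := extend_pair inv1 (introN idP cU) Tv zg.
exists (V + E)%VS; split; last by apply: contra EV; apply: subv_trans; exact: addvSr.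
  apply/nullingP; exists F; split=> // _ /memv_addP[y yV [e eE ->]].
  rewrite mulmxDr !mulmxDl -!mulmxA FV// FE// !mulmxA -!mulmxDl null1// add0r.
  apply: null2; move: (subvP EW _ eE); apply/subvP.
  by case/andP: vW => rW iW; rewrite subv_add -!memvE rW.
exact: addvSl.
Qed.

Lemma nulling0 : nulling 0%VS.
Proof.
apply/nullingP; exists 0; split; last by move=> v; rewrite memv0 => /eqP->; rewrite mulmx0.
split=> [v|x z x0 /andP[]]; first by rewrite memv0 => /eqP->; rewrite mulmx0 mem0v.
rewrite !memv0 => /eqP re /eqP im; case/eqP: x0; rewrite [x]cplx_mx_split re im.
by apply/matrixP => i j; rewrite !mxE mulr0 addr0.
Qed.

(** An output-nulling subspace of maximal dimension contains all the others, by
    [nulling_enlarge]. *)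
Lemma Vstar_gP : nulling Vg /\ forall W, nulling W -> (W <= Vg)%VS.
Proof.
rewrite /Vstar_g; apply: (@xgetPex _ _ [set V | nulling V /\ forall W, nulling W -> (W <= V)%VS]).
pose P k := `[< exists V, nulling V /\ \dim V = k >].
have exP : exists k, P k.
  exists 0%N; apply/asboolP; exists 0%VS.
  by rewrite dimv0; split=> //; exact: nulling0.
have bound k : P k -> (k <= n)%N.
  by move=> /asboolP[V [_ <-]]; rewrite -[leqRHS]dim_cV dimvS// subvf.
case: (ex_maxnP exP bound) => k /asboolP[V [nV <-]] Vmax.
exists V; split=> // W nW; apply/negP => /negP /(nulling_enlarge nV nW)[V' [nV' VV' V'V]].
have := Vmax (\dim V') (asboolT (ex_intro _ V' (conj nV' erefl))).
by move=> /(conj VV')/andP; rewrite -eqEdim => /eqP VE; rewrite -VE subvv in V'V.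
Qed.

(** The key consequence of maximality. With [v] outside the largest subspace, the
    line it spans could be added as a new stable mode with zero output. *)
Lemma Vstar_g_absorbs s v w : Cgood td (real_complex R s) ->
  A *m v + B *m w - s *: v \in Vg -> C *m v + D *m w = 0 -> v \in Vg.
Proof.
move=> sg vw out; apply/negP => /negP vV.
have [/nullingP[F1 [inv1 null1]] Vmax] := Vstar_gP.
have [F [FV Fv invF]] := extend_line inv1 vV vw sg.
case/negP: vV; rewrite memvE; apply: subv_trans (addvSr Vg _) (Vmax _ _).
apply/nullingP; exists F; split=> // _ /memv_addP[y yV [_ /vlineP[k ->] ->]].
rewrite mulmxDr -scalemxAr !mulmxDl -!mulmxA FV// Fv out scaler0 addr0.
by rewrite mulmxA -mulmxDl null1.
Qed.
End LargestSubspace.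

(** * Right invertibility away from the zeros *)

Section RightInvertibility.
Local Open Scope classical_set_scope.
Context (R : realType) (n m p : nat).
Context (A : 'M[R]_n) (B : 'M[R]_(n, m)) (C : 'M[R]_(p, n)) (D : 'M[R]_(p, m)).

Local Notation rosen s := (block_mx (A - s%:M) B C D).

Lemma horner_rosenbrock s :
  map_mx (horner_eval s) (rosenbrock A B C D) = rosen s.
Proof.
rewrite map_block_mx map_mxB map_scalar_mx /= /horner_eval hornerX.
have evC k l (M : 'M[R]_(k, l)) : map_mx (horner_eval s) (map_mx polyC M) = M.
  by apply/matrixP => i j; rewrite !mxE /horner_eval hornerC.
by rewrite !evC.
Qed.

Lemma rosenbrock_at_real s :
  rosenbrock_at A B C D (real_complex R s) = map_mx (real_complex R) (rosen s).
Proof.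
rewrite -horner_rosenbrock; apply/matrixP => i j.
by rewrite ![_ i j]mxE horner_map.
Qed.

(** The exceptional set is finite, so the rank is full at some real point [r];
    a right inverse [U] at [r] makes the determinant of the polynomial matrix
    [P U] nonzero at [r], hence nonzero. *)
Lemma normal_rank_full : right_invertible A B C D ->
  normal_rank (rosenbrock A B C D) = (n + p)%N.
Proof.
move=> fin; have [r rfull] : exists r, \rank (rosen r) = (n + p)%N.
  apply: contrapT => /forallNP rdef; apply: infinite_nat.
  pose f k := real_complex R (k%:R : R).
  apply: sub_finite_set (finite_preimage (f := f) _ fin).
    by move=> k _ /=; rewrite rosenbrock_at_real mxrank_map.
  by move=> k l _ _ /complexI/eqP; rewrite eqr_nat => /eqP.
have /row_freeP[U PU] : row_free (rosen r) by rewrite /row_free rfull.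
have detPU : \det (rosenbrock A B C D *m map_mx polyC U) != 0.
  apply/eqP => /(congr1 (horner_eval r)); rewrite -det_map_mx map_mxM.
  rewrite horner_rosenbrock -map_mx_comp (_ : map_mx _ U = U) ?PU; last first.
    by apply/matrixP => i j; rewrite !mxE /= /horner_eval hornerC.
  by rewrite det1 /horner_eval horner0 => /eqP; rewrite oner_eq0.
apply/eqP; rewrite eqn_leq rank_leq_row /normal_rank.
apply: leq_trans (mxrankM_maxl _ (map_mx (@tofrac _) (map_mx polyC U))).
rewrite -map_mxM mxrank_unit// unitmxE det_map_mx unitfE.
by rewrite tofrac_eq0.
Qed.

(** Outside the invariant zeros the rank is at least the normal rank, which is
    the number of rows. *)
Lemma rosenbrock_onto s : right_invertible A B C D ->
  ~ invariant_zeros A B C D (real_complex R s) ->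
  forall (y : 'cV_n) (g : 'cV_p), exists v w,
    A *m v + B *m w - s *: v = y /\ C *m v + D *m w = g.
Proof.
move=> rinv; rewrite /invariant_zeros /= normal_rank_full// rosenbrock_at_real.
rewrite mxrank_map => /negP; rewrite -leqNgt => full y g.
have /row_freeP[U PU] : row_free (rosen s).
  by rewrite /row_free eqn_leq rank_leq_row.
exists (usubmx (U *m col_mx y g)), (dsubmx (U *m col_mx y g)).
have := mulmxA (rosen s) U (col_mx y g); rewrite PU mul1mx.
rewrite -{1}[U *m _]vsubmxK mul_block_col => /eq_col_mx[yE gE].
by split=> //; rewrite -[RHS]yE mulmxBl mul_scalar_mx addrAC.
Qed.
End RightInvertibility.

(** * Decoupling feedbacks and the span condition *)

Section Decoupling.
Context (R : realType) (td : time_domain) (n m p : nat).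
Context (A : 'M[R]_n) (B : 'M[R]_(n, m)) (C : 'M[R]_(p, n)) (D : 'M[R]_(p, m)).
Context (lambda : 'I_p -> R).
Implicit Types (V W E : {vspace 'cV[R]_n}) (F : 'M[R]_(m, n)).

Local Notation Vg := (Vstar_g td A B C D).
Local Notation Rs j := (Rstar A B C D j (lambda j)).

(** With [G = C + D F] and [N = A + B F], this is [G N = L G] on [V], where [L] is
    the diagonal matrix of [lambda]: along [V], each row of [G] is either zero or a
    left eigenvector of [N] for its own mode. *)
Definition decoupled_on F V : Prop := forall v k, v \in V ->
  ((C + D *m F) *m ((A + B *m F) *m v)) k 0 = lambda k * ((C + D *m F) *m v) k 0.

Lemma row'_mul k l q (j : 'I_k) (M : 'M[R]_(k, l)) (N : 'M[R]_(l, q)) :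
  row' j M *m N = row' j (M *m N).
Proof. by apply/matrixP => i h; rewrite !mxE; apply: eq_bigr => ? _; rewrite !mxE. Qed.

Lemma RstarP j v : v \in Rs j <-> exists w,
  A *m v + B *m w - lambda j *: v = 0 /\
  forall i, i != j -> (C *m v + D *m w) i 0 = 0.
Proof.
rewrite mem_Rstar; split=> -[w [dyn out]]; exists w; split.
- by rewrite addrAC -mul_scalar_mx -mulmxBl.
- move=> i; rewrite eq_sym => /unlift_some[i' -> _].
  move/(congr1 (fun M : 'cV_p.-1 => M i' 0)): out.
  by rewrite !row'_mul -[in X in X -> _]raddfD /= !mxE.
- by rewrite mulmxBl mul_scalar_mx addrAC.
- apply/matrixP => i k; rewrite ord1 !row'_mul -[in LHS]raddfD /= mxE out ?mxE//.
  by rewrite eq_sym neq_lift.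
Qed.

Context (lambda_good : forall j, Cgood td (real_complex R (lambda j))).

(** A vector [v] of the subspace attached to [j] can be made an eigenvector for
    [lambda j] with output along the [j]-th axis, so that the intertwining
    relation persists on the enlarged subspace. *)
Lemma decouple_more V F v j : stably_invariant td A B F V -> decoupled_on F V ->
  v \in Rs j -> exists F', stably_invariant td A B F' (V + <[v]>) /\
    decoupled_on F' (V + <[v]>).
Proof.
move=> inv dec /RstarP[w [dyn out]]; have [vV|vV] := boolP (v \in V).
  by exists F; move: vV; rewrite memvE => /addv_idPl ->.
have [|F' [FV Fv inv']] := extend_line inv vV (w := w) _ (lambda_good j).
  by rewrite dyn mem0v.
exists F'; split=> // _ k /memv_addP[y yV [_ /vlineP[c ->] ->]].
have Gv : (C + D *m F') *m v = C *m v + D *m w by rewrite mulmxDl -mulmxA Fv.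
have Nv : (A + B *m F') *m v = lambda j *: v.
  by rewrite mulmxDl -mulmxA Fv; apply/eqP; rewrite -subr_eq0 dyn.
have GV u : u \in V -> (C + D *m F') *m u = (C + D *m F) *m u.
  by move=> uV; rewrite !mulmxDl -!mulmxA FV.
have Ny : (A + B *m F') *m y = (A + B *m F) *m y by rewrite !mulmxDl -!mulmxA FV.
rewrite !mulmxDr -!scalemxAr Ny Nv -scalemxAr Gv !GV ?inv.1//.
rewrite [LHS]mxE [in RHS]mxE dec// mulrDr; congr (_ + _).
move: (C *m v + D *m w) out {Gv} => g out; rewrite !mxE.
by have [->|kj] := eqVneq k j; [ring|rewrite out//; ring].
Qed.

(** Start from the largest stable output-nulling subspace, where the output
    vanishes, and add generators of the subspaces one at a time. *)
Lemma decoupling_exists : (Vg + \sum_j Rs j = fullv)%VS ->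
  exists F, asymp_stable td (A + B *m F) /\ decoupled_on F fullv.
Proof.
pose vs := flatten [seq vbasis (Rs j) : seq _ | j <- enum 'I_p].
have sR v : v \in vs -> exists j, v \in Rs j.
  by move=> /flattenP[_ /mapP[j _ ->] vR]; exists j; apply: vbasis_mem.
have [F [inv dec]] : exists F, stably_invariant td A B F (Vg + <<vs>>) /\
    decoupled_on F (Vg + <<vs>>).
  elim: (vs) sR => [|v t IH] sR.
    have [/nullingP[F [inv null]] _] := Vstar_gP td A B C D.
    exists F; rewrite span_nil addv0; split=> // v k vV.
    by rewrite !null ?inv.1// !mxE mulr0.
  have [|F [inv dec]] := IH; first by move=> u ut; apply: sR; rewrite inE ut orbT.
  have [j vj] := sR v (mem_head _ _).
  have := decouple_more inv dec vj.
  by rewrite span_cons -addvA [(<<t>> + _)%VS]addvC.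
move=> full; have VgE : (Vg + <<vs>> = fullv)%VS.
  apply/eqP; rewrite eqEsubv subvf -full addvS//; apply/subv_sumP => j _.
  rewrite -(span_basis (vbasisP (Rs j))); apply: sub_span => v vj.
  by apply/flattenP; exists (vbasis (Rs j) : seq _) => //; apply: map_f; rewrite mem_enum.
rewrite VgE in inv dec; exists F; split=> //; apply/asymp_stableP.
exact: inv.2.
Qed.

Context (onto : forall j (y : 'cV_n) (g : 'cV_p), exists v w,
  A *m v + B *m w - lambda j *: v = y /\ C *m v + D *m w = g).

Lemma Rstar_output j (c : R) : exists v w,
  [/\ v \in Rs j, A *m v + B *m w - lambda j *: v = 0
    & C *m v + D *m w = c *: delta_mx j 0].
Proof.
have [v [w [dyn out]]] := onto j 0 (c *: delta_mx j 0).
exists v, w; split=> //; apply/RstarP; exists w; split=> // i ij.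
by rewrite out !mxE (negPf ij) mulr0.
Qed.

(** Two elements of the [j]-th subspace with the same output differ by a vector
    with zero output, which is absorbed; and the output has a single free
    component. *)
Lemma Rstar_line_mod_Vstar j : exists v, v \in Rs j /\ (Rs j <= Vg + <[v]>)%VS.
Proof.
have [v [w [vR dyn out]]] := Rstar_output j 1; exists v; split=> //.
apply/subvP => x /RstarP[u [xdyn xout]].
pose c := (C *m x + D *m u) j 0.
rewrite -[x](subrK (c *: v)) memv_add// ?memvZ ?memv_line//.
apply: (@Vstar_g_absorbs _ _ _ _ _ A B C D (lambda j) _ (u - c *: w)) => //.
  rewrite !mulmxBr -!scalemxAr scalerBr.
  rewrite (_ : _ - _ = (A *m x + B *m u - lambda j *: x)
      - c *: (A *m v + B *m w - lambda j *: v)); last first.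
    by apply/matrixP => i k; rewrite !mxE; ring.
  by rewrite xdyn dyn scaler0 subr0 mem0v.
rewrite !mulmxBr -!scalemxAr addrACA -opprD -scalerDr out scale1r.
apply/matrixP => i k; rewrite ord1 [LHS]mxE [X in _ + X]mxE [X in - X]mxE [RHS]mxE.
have [->|ij] := eqVneq i j; first by rewrite /c [delta_mx _ _ _ _]mxE !eqxx mulr1 subrr.
by rewrite xout// mxE (negPf ij) mulr0 subr0.
Qed.

(** The kernel of the output map is stable and output-nulling, hence contained in
    the largest such subspace; so a state only matters through its output
    [G v]. If [G v] is supported on indices with the same mode [mu], then
    [N v - mu v] has zero output, and subtracting elements of the subspaces
    that carry each output component leaves a vector to be absorbed. In general,
    induct on the support of [G v]: for two different modes in it,
    [N v - lambda i v] and [N v - lambda j v] have smaller supports and their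
    difference is a nonzero multiple of [v]. *)
Lemma decoupled_span F : asymp_stable td (A + B *m F) -> decoupled_on F fullv ->
  (Vg + \sum_j Rs j = fullv)%VS.
Proof.
move=> /asymp_stableP stN dec; set Y := (_ + _)%VS.
pose N := A + B *m F; pose G := C + D *m F.
have {}dec (v : 'cV_n) k : (G *m (N *m v)) k 0 = lambda k * (G *m v) k 0.
  exact: (dec v k (memvf v)).
have [_ Vmax] := Vstar_gP td A B C D.
have kerG (v : 'cV_n) : G *m v = 0 -> v \in Vg.
  move=> Gv; apply: (subvP (Vmax (lker (linfun (mulmx G : 'cV_n -> 'cV_p))) _)).
    apply/nullingP; exists F; split; last by move=> u; rewrite memv_ker lfunE => /eqP.
    split=> [u|x z x0 _]; last by apply: stN => //; rewrite /cmem !memvf.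
    rewrite !memv_ker !lfunE /= => /eqP Gu; apply/eqP/matrixP => i k.
    by rewrite ord1 dec Gu !mxE mulr0.
  by rewrite memv_ker lfunE /= Gv.
have VY v : v \in Vg -> v \in Y by apply: (subvP (addvSl _ _)).
have RY j v : v \in Rs j -> v \in Y.
  by move=> vj; apply: (subvP (addvSr _ _)); apply: (subvP (sumv_sup j _ _)) vj.
have GNE mu (v : 'cV_n) k : (G *m (N *m v - mu *: v)) k 0 = (lambda k - mu) * (G *m v) k 0.
  by rewrite mulmxBr -scalemxAr [LHS]mxE dec [X in _ + X]mxE [X in - X]mxE mulrBl.
have main k (S : {set 'I_p}) : (#|S| <= k)%N -> forall v : 'cV_n,
    (forall i, i \notin S -> (G *m v) i 0 = 0) -> v \in Y.
  elim: k S => [|k IH] S Sk v GvS.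
    apply/VY/kerG/matrixP => i j; rewrite ord1 [RHS]mxE GvS//.
    by move: Sk; rewrite leqn0 cards_eq0 => /eqP->; rewrite inE.
  have [/existsP[i /existsP[j /and3P[iS jS ij]]]|] :=
      boolP [exists i, exists j, [&& i \in S, j \in S & lambda i != lambda j]].
    have drop h : h \in S -> N *m v - lambda h *: v \in Y.
      move=> hS; apply: (IH (S :\ h)).
        by move: Sk; rewrite (cardsD1 h) hS.
      move=> l; rewrite !inE negb_and negbK => /orP[/eqP->|lS].
        by rewrite GNE subrr mul0r.
      by rewrite GNE GvS ?mulr0.
    have : (N *m v - lambda i *: v) - (N *m v - lambda j *: v) \in Y.
      by rewrite memvB ?drop.
    rewrite opprB addrC subrKA -scalerBl.
    have d0 : lambda j - lambda i != 0 by rewrite subr_eq0 eq_sym.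
    by move=> /(memvZ (lambda j - lambda i)^-1); rewrite scalerA mulVf// scale1r.
  rewrite negb_exists => /forallP same.
  have [S0|[j0 j0S]] := set_0Vmem S.
    by apply/VY/kerG/matrixP => i j; rewrite ord1 [RHS]mxE GvS// S0 inE.
  have eqmu i : i \in S -> lambda i = lambda j0.
    move=> iS; have := same i; rewrite negb_exists => /forallP/(_ j0).
    by rewrite iS j0S /= negbK => /eqP.
  pose mu := lambda j0.
  have /choice[u Hu] j := Rstar_output j ((G *m v) j 0).
  have /choice[w Huw] := Hu.
  pose v' := v - \sum_(j in S) u j; pose w' := F *m v - \sum_(j in S) w j.
  have v'V : v' \in Vg.
    apply: (@Vstar_g_absorbs _ _ _ _ _ A B C D mu _ w'); first exact: lambda_good.
      have -> : A *m v' + B *m w' - mu *: v' = (N *m v - mu *: v)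
          - \sum_(j in S) (A *m u j + B *m w j - lambda j *: u j).
        rewrite /v' /w' !mulmxBr scalerBr !mulmx_sumr scaler_sumr mulmxA.
        rewrite sumrB big_split /= mulmxDl.
        have -> : \sum_(j in S) lambda j *: u j = \sum_(j in S) mu *: u j.
          by apply: eq_bigr => j jS; rewrite eqmu.
        by apply/matrixP => i k'; rewrite !mxE; ring.
      rewrite big1 ?subr0 => [|j _]; last by have [] := Huw j.
      apply/kerG/matrixP => i k'; rewrite ord1 GNE [RHS]mxE.
      have [iS|iS] := boolP (i \in S); first by rewrite eqmu// subrr mul0r.
      by rewrite GvS ?mulr0.
    rewrite !mulmxBr !mulmx_sumr mulmxA addrACA -mulmxDl -opprD -big_split /=.
    rewrite (eq_bigr (fun j => (G *m v) j 0 *: delta_mx j 0)); last first.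
      by move=> j _; have [] := Huw j.
    apply/matrixP => i k'; rewrite ord1 [LHS]mxE [X in _ + X]mxE summxE [RHS]mxE.
    have [iS|iS] := boolP (i \in S).
      rewrite (bigD1 i)//= big1 ?addr0; first by rewrite !mxE !eqxx mulr1 subrr.
      by move=> j /andP[_ ji]; rewrite !mxE eq_sym (negPf ji) mulr0.
    rewrite -/G GvS// big1 ?subr0// => j jS; rewrite !mxE.
    by have [ij|] := eqVneq i j; rewrite ?mulr0//; rewrite ij jS in iS.
  rewrite -[v](subrK (\sum_(j in S) u j)) memvD//; first exact: VY.
  by apply: memv_suml => j _; apply: (RY j); have [] := Huw j.
apply/eqP; rewrite eqEsubv subvf; apply/subvP => v _.
by apply: (main _ (finset.setTfor 'I_p) (leqnn _)) => i; rewrite inE.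
Qed.

(** Dropping an index costs at most one dimension, as every subspace is at most a
    line modulo the largest output-nulling one. *)
Lemma dim_partial_span (S : {set 'I_p}) : (Vg + \sum_j Rs j = fullv)%VS ->
  (n <= \dim (Vg + \sum_(j in S) Rs j) + (p - #|S|))%N.
Proof.
move=> full; have /choice[v vP] := Rstar_line_mod_Vstar.
pose L := (\sum_(j in ~: S) <[v j]>)%VS.
have dimL : (\dim L <= p - #|S|)%N.
  apply: leq_trans (dimv_leq_sum _ _ _) _.
  have -> : (p - #|S|)%N = #|~: S| by rewrite [RHS]cardsCs finset.setCK card_ord.
  rewrite -sum1_card.
  by apply: leq_sum => j _; rewrite dim_vline leq_b1.
apply: leq_trans (leq_add (leqnn _) dimL).
apply: leq_trans (dimv_add_leqif _ _).1.
rewrite -[leqLHS](dim_cV R n) -full dimvS// subv_add.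
rewrite -addvA addvSl /=; apply/subv_sumP => j _.
have [jS|jS] := boolP (j \in S).
  apply: subv_trans (addvSr Vg _); apply: subv_trans (addvSl _ L).
  exact: (sumv_sup j).
apply: subv_trans (vP j).2 _; apply: addvS => //; apply: subv_trans (addvSr _ L).
by apply: (sumv_sup j) => //; rewrite inE.
Qed.
End Decoupling.

(** * Linear differential equations *)

Section LinearFlow.
Local Open Scope classical_set_scope.
Context (R : realType).

Lemma cvg_lincomb (T : Type) (F : set_system T) (FF : Filter F) k
    (c : 'I_k -> R) (f : 'I_k -> T -> R) (l : 'I_k -> R) :
  (forall i, f i s @[s --> F] --> l i) ->
  \sum_i c i * f i s @[s --> F] --> \sum_i c i * l i.
Proof.
move=> fl.
have -> : (fun s => \sum_i c i * f i s) = \sum_i (fun s => c i * f i s).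
  by apply/funext => s; rewrite fct_sumE.
elim/big_ind2: _ => [|g a h b ga hb|i _]; first exact: cvg_cst.
  exact: cvgD.
by apply: cvgM; [exact: cvg_cst|exact: fl].
Qed.

Lemma is_derive_lincomb k (c : 'I_k -> R) (f : 'I_k -> R -> R) (df : 'I_k -> R) (t : R) :
  (forall i, is_derive t (1 : R) (f i) (df i)) ->
  is_derive t 1 (fun s => \sum_i c i * f i s) (\sum_i c i * df i).
Proof.
move=> dfi; have -> : (fun s => \sum_i c i * f i s) = \sum_i (c i \*: f i).
  by apply/funext => s; rewrite fct_sumE.
by apply: is_derive_sum => i; exact: is_deriveZ.
Qed.

Lemma is_derive_mode (l t : R) :
  is_derive t 1 (fun s => expR (l * s)) (l * expR (l * t)).
Proof.
have dl : is_derive t (1 : R) (fun u : R => l * u) l.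
  have : is_derive t (1 : R) (l \*: (@id R)) (l *: 1) by exact: is_deriveZ.
  by rewrite [_ *: _]mulr1.
have := @is_derive1_comp R expR (fun u => l * u) t _ _ (is_derive_expR _) dl.
by rewrite mulrC.
Qed.

(** The product of [f] with the inverse mode has zero derivative. *)
Lemma scalar_flow_unique (f : R -> R) (l : R) :
  (forall t : R, 0 < t -> is_derive t 1 f (l * f t)) -> f s @[s --> 0^'+] --> f 0 ->
  forall t : R, 0 <= t -> f t = f 0 * expR (l * t).
Proof.
move=> df f0 t; rewrite le_eqVlt => /predU1P[<-|t0].
  by rewrite mulr0 expR0 mulr1.
pose e s : R := expR (- l * s).
have de (s : R) : is_derive s 1 e (- l * e s) by exact: is_derive_mode.
have dg (s : R) : 0 < s -> is_derive s 1 (f * e) 0.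
  move=> s0; apply: (is_derive_eq (is_deriveM (df s s0) (de s))).
  by rewrite /GRing.scale /=; ring.
have [||c _] := @MVT R (f * e) (fun=> 0) 0 t t0.
- by move=> s; rewrite in_itv /= => /andP[s0 _]; exact: dg.
- have cg (s : R) : 0 < s -> {for s, continuous (f * e)}.
    by move=> s0; have [d _] := dg s s0; apply/differentiable_continuous/derivable1_diffP.
  apply/continuous_within_itvP => //; split.
  + by move=> s; rewrite in_itv /= => /andP[s0 _]; exact: cg.
  + apply: cvgM => //; apply: cvg_at_right_filter.
    by have [d _] := de 0; apply/differentiable_continuous/derivable1_diffP.
  + by apply: cvg_at_left_filter; exact: cg.
rewrite mul0r => /eqP; rewrite subr_eq0 => /eqP.
rewrite -[(f * e) t]/(f t * e t) -[(f * e) 0]/(f 0 * e 0) {2}/e mulr0 expR0 mulr1.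
by move=> <-; rewrite -mulrA -expRD -mulrDl addNr mul0r expR0 mulr1.
Qed.

Section Flow.
Context (n : nat) (N : 'M[R]_n).

(** The solution is given by the exponential series, one coordinate at a time, so
    that the theory of scalar power series applies. *)
Definition flow_coef (x0 : 'cV[R]_n) (i : 'I_n) (k : nat) : R :=
  (iter k (mulmx N) x0) i 0 / k`!%:R.

Definition flow (x0 : 'cV[R]_n) (t : R) : 'cV[R]_n :=
  \col_i limn (pseries (flow_coef x0 i) t).

(** Formal differentiation shifts the starting point to its image by [N]. *)
Lemma flow_coef_diffs x0 i : pseries_diffs (flow_coef x0 i) = flow_coef (N *m x0) i.
Proof.
apply/funext => k; rewrite /pseries_diffs /flow_coef -iterSr.
by rewrite factS natrM invfM mulrCA mulVKf// pnatr_eq0.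
Qed.

(** Geometric growth in the norm that sums absolute values; it gives an
    exponential majorant of the coefficients. *)
Lemma iter_mulmx_bound k (x0 : 'cV[R]_n) :
  \sum_i `|(iter k (mulmx N) x0) i 0| <=
  (\sum_i \sum_j `|N i j|) ^+ k * \sum_i `|x0 i 0|.
Proof.
elim: k => [|k IH]; first by rewrite expr0 mul1r.
rewrite iterS exprS -mulrA; set y := iter k _ _ in IH *.
apply: (@le_trans _ _ ((\sum_i \sum_j `|N i j|) * \sum_i `|y i 0|)); last first.
  by rewrite ler_wpM2l// sumr_ge0// => i _; rewrite sumr_ge0.
rewrite mulr_suml; apply: ler_sum => i _; rewrite mxE mulr_suml.
apply: le_trans (ler_norm_sum _ _ _) _; apply: ler_sum => j _.
rewrite normrM ler_wpM2l// (bigD1 j)//= lerDl sumr_ge0//.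
Qed.

Lemma flow_cvg x0 i t : cvgn (pseries (flow_coef x0 i) t).
Proof.
pose r := \sum_i \sum_j `|N i j|; pose M := \sum_i `|x0 i 0|.
have r0 : 0 <= r by apply: sumr_ge0 => ? _; apply: sumr_ge0.
have M0 : 0 <= M by apply: sumr_ge0.
apply: normed_cvg; rewrite /normed_series_of /=.
apply: (@series_le_cvg _ _ (fun k => M * exp_coeff (r * `|t|) k)) => [k|k|k|].
- by [].
- by rewrite mulr_ge0// exp_coeff_ge0// mulr_ge0.
- rewrite /exp_coeff /flow_coef /= (_ : `|_| =
    `|iter k (mulmx N) x0 i 0| * (`|t| ^+ k / k`!%:R)); last first.
    by rewrite !normrM normrX normfV normr_nat mulrAC mulrA.
  rewrite (_ : M * _ = r ^+ k * M * (`|t| ^+ k / k`!%:R)); last first.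
    by rewrite exprMn; ring.
  apply: ler_wpM2r; first by rewrite divr_ge0// exprn_ge0.
  apply: le_trans (iter_mulmx_bound k x0).
  by rewrite (bigD1 i)//= lerDl sumr_ge0.
- exact: is_cvg_seriesZ (is_cvg_series_exp_coeff (r * `|t|)).
Qed.

Lemma is_derive_flow x0 (t : R) i :
  is_derive t 1 (fun s => flow x0 s i 0) ((N *m flow x0 t) i 0).
Proof.
have -> : (fun s => flow x0 s i 0) = (fun s => limn (pseries (flow_coef x0 i) s)).
  by apply/funext => s; rewrite mxE.
have := @pseries_snd_diffs R (flow_coef x0 i) (`|t| + 1) t.
have tt : `|t| < `| `|t| + 1| by rewrite [ltRHS]ger0_norm ?addr_ge0// ltrDl.
rewrite !flow_coef_diffs => /(_ _ _ _ tt) df.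
apply: (is_derive_eq (df _ _ _)); try exact: flow_cvg.
apply/cvg_lim => //.
rewrite mxE.
have -> : pseries (flow_coef (N *m x0) i) t =
    (fun k => \sum_j N i j * pseries (flow_coef x0 j) t k).
  apply/funext => k; rewrite /pseries /series /=.
  under [RHS]eq_bigr do rewrite mulr_sumr.
  rewrite exchange_big /=; apply: eq_bigr => h _.
  rewrite /flow_coef -iterSr iterS mxE !mulr_suml.
  by apply: eq_bigr => j _; rewrite !mulrA.
apply: cvg_lincomb => j; rewrite mxE; exact: flow_cvg.
Qed.

Lemma flow0 x0 : flow x0 0 = x0.
Proof.
apply/matrixP => i j; rewrite ord1 mxE; apply: lim_near_cst => //.
near=> k; have k0 : (0 < k)%N by near: k; exists 1%N.
rewrite -(prednK k0) /pseries /series /= big_nat_recl// big1 ?addr0 => [|h _].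
  by rewrite expr0 mulr1 /flow_coef /= fact0 divr1.
by rewrite expr0n mulr0.
Unshelve. all: by end_near. Qed.
End Flow.
End LinearFlow.

(** * Closed-loop trajectories *)

Section ClosedLoop.
Local Open Scope classical_set_scope.
Context (R : realType) (td : time_domain) (n m p : nat).
Context (A : 'M[R]_n) (B : 'M[R]_(n, m)) (C : 'M[R]_(p, n)) (D : 'M[R]_(p, m)).
Context (lambda : 'I_p -> R) (F : 'M[R]_(m, n)).

Local Notation N := (A + B *m F).
Local Notation G := (C + D *m F).

Lemma closed_loop k (M : 'M[R]_(k, n)) (L : 'M[R]_(k, m)) xss uss x :
  M *m x + L *m control F xss uss x =
  (M + L *m F) *m (x - xss) + (M *m xss + L *m uss).
Proof.
rewrite /control mulmxDr !addrA; congr (_ + _).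
by rewrite mulmxDl addrAC -mulmxDr subrK mulmxA.
Qed.

(** Take the zero reference and an arbitrary initial state. In discrete time,
    compare the error at times 0 and 1. In continuous time, compare its two
    derivatives at positive times and let the time tend to 0; this requires a
    solution through every initial state, provided by [flow]. *)
Lemma decoupled_of_solution : problem3_solution td A B C D lambda F ->
  decoupled_on A B C D lambda F fullv.
Proof.
case=> _ [beta /(_ 0) [_ sol]] x0 k _.
have st0 : steady_state td A B C D 0 0 0 by split; rewrite !mulmx0 addr0 ?scaler0.
have {}sol (x : time R td -> 'cV[R]_n) : solves (mulmx N) x ->
    forall t, nonneg_time t ->
    (G *m x t) k 0 = beta (x (time0 R td)) k * mode (lambda k) t.
  move=> xs t t0; have := sol 0 0 st0 x _ t t0 k.
  rewrite closed_loop !mulmx0 !subr0 !addr0; apply.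
  rewrite (_ : (fun v => _) = mulmx N)//; apply/funext => v.
  by rewrite closed_loop !mulmx0 !addr0 subr0.
move: beta sol {st0}; case: td => beta /= sol.
- pose x := flow N x0.
  have dx t i : is_derive t (1 : R) (fun s => x s i 0) ((N *m x t) i 0).
    exact: is_derive_flow.
  have cx t i : x s i 0 @[s --> t] --> x t i 0.
    by have [d _] := dx t i; apply/differentiable_continuous/derivable1_diffP.
  have {}sol t : 0 <= t -> (G *m x t) k 0 = beta (x 0) k * expR (lambda k * t).
    by apply: sol => i; split=> [s _|]; [exact: dx | exact/cvg_at_right_filter].
  have lin (M : 'M[R]_(p, n)) t : (M *m x s) k 0 @[s --> t] --> (M *m x t) k 0.
    rewrite mxE (_ : (fun s => _) = fun s => \sum_i M k i * x s i 0).
      by apply: cvg_lincomb => i; exact: cx.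
    by apply/funext => s; rewrite mxE.
  have pos (t : R) : 0 < t -> (G *m (N *m x t)) k 0 = lambda k * (G *m x t) k 0.
    move=> t0.
    have d1 : is_derive t (1 : R) (fun s => (G *m x s) k 0) ((G *m (N *m x t)) k 0).
      rewrite [X in is_derive _ _ _ X]mxE (_ : (fun s => _) = fun s => \sum_i G k i * x s i 0).
        by apply: is_derive_lincomb => i; exact: dx.
      by apply/funext => s; rewrite mxE.
    have d2 : is_derive t (1 : R) (fun s => (G *m x s) k 0)
        (lambda k * (beta (x 0) k * expR (lambda k * t))).
      apply: (@near_eq_is_derive _ _ _ (fun s => beta (x 0) k * expR (lambda k * s))).
        near=> s; rewrite sol//; apply: ltW; near: s; exact: lt_nbhsr.
      apply: (is_derive_eq (is_deriveZ (beta (x 0) k) (is_derive_mode (lambda k) t))).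
      by rewrite /GRing.scale /=; ring.
    by rewrite -(@derive_val _ _ _ _ _ _ _ d1) (@derive_val _ _ _ _ _ _ _ d2) sol// ltW.
  have x00 : x 0 = x0 by exact: flow0.
  rewrite -x00.
  have l1 : (G *m (N *m x s)) k 0 @[s --> 0^'+] --> (G *m (N *m x 0)) k 0.
    under eq_fun do rewrite mulmxA; rewrite mulmxA.
    by apply: cvg_at_right_filter; exact: lin.
  have l2 : (G *m (N *m x s)) k 0 @[s --> 0^'+] --> lambda k * (G *m x 0) k 0.
    have : lambda k * (G *m x s) k 0 @[s --> 0^'+] --> lambda k * (G *m x 0) k 0.
      by apply: cvgM; [exact: cvg_cst | apply: cvg_at_right_filter; exact: lin].
    apply: cvg_trans; apply: near_eq_cvg; near=> s.
    by rewrite pos//; near: s; exact: nbhs_right_gt.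
  exact: (cvg_unique _ l1 l2).
- pose x t := iter t (mulmx N) x0.
  have xs t : x t.+1 = N *m x t by [].
  have := sol x xs 0%N I; have := sol x xs 1%N I.
  by rewrite /= expr0 expr1 mulr1 mulrC => -> ->.
Unshelve. all: by end_near. Qed.

(** Each error component solves a scalar equation with rate [lambda k]. *)
Lemma solution_of_decoupled : asymp_stable td N ->
  decoupled_on A B C D lambda F fullv ->
  (forall r, exists xss uss, steady_state td A B C D r xss uss) ->
  problem3_solution td A B C D lambda F.
Proof.
move=> stN dec steady; split=> //.
exists (fun xi k => (G *m xi) k 0) => r; split=> // xss uss [ss out] x.
move=> + t t0 k; rewrite closed_loop out addrK.
rewrite (_ : (fun v => _) = fun v => N *m (v - xss) + steady_value R td *: xss); last first.
  by apply/funext => v; rewrite closed_loop ss.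
move: x t t0 {ss steady stN}; case: td => /= x t t0 sol.
- have E s : (G *m (x s - xss)) k 0 = \sum_i G k i * (x s i 0 - xss i 0).
    by rewrite mxE; apply: eq_bigr => i _; rewrite !mxE.
  apply: (@scalar_flow_unique R (fun s => (G *m (x s - xss)) k 0)) => // [s s0|].
    rewrite -dec ?memvf// mxE.
    rewrite (_ : (fun s => _) = fun s => \sum_i G k i * (x s i 0 - xss i 0)); last first.
      exact/funext.
    apply: is_derive_lincomb => i; have [/(_ s s0) + _] := sol i.
    rewrite scale0r addr0 => dx.
    have := is_deriveB dx (is_derive_cst (xss i 0) s 1).
    by rewrite subr0.
  rewrite E (_ : (fun s => _) = fun s => \sum_i G k i * (x s i 0 - xss i 0)); last first.
    exact/funext.
  apply: cvg_lincomb => i; have [_ cx] := sol i.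
  by apply: cvgB => //; exact: cvg_cst.
- have {}sol s : x s.+1 - xss = N *m (x s - xss) by rewrite sol scale1r addrK.
  elim: t {t0} => [|t IH]; first by rewrite expr0 mulr1.
  by rewrite sol dec ?memvf// IH exprS mulrCA.
Qed.
End ClosedLoop.

(** * The solvability criterion *)

Lemma Lgood_Cgood (R : realType) td (l : R) :
  Lgood td l -> Cgood td (real_complex R l).
Proof.
case: td => //= /andP[l0 l1]; rewrite normc_def /= expr0n addr0 sqrtr_sqr.
by rewrite ger0_norm// ltcR.
Qed.

Theorem theorem3 (R : realType) (td : time_domain) (n m p : nat)
  (A : 'M[R]_n) (B : 'M[R]_(n, m)) (C : 'M[R]_(p, n)) (D : 'M[R]_(p, m))
  (lambda : 'I_p -> R) :
  standing_assumptions B C D ->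
  assumption1 td A B C D ->
  assumption2 td A B C D ->
  (forall k : 'I_p, Lgood td (lambda k)) ->
  (forall k : 'I_p, ~ invariant_zeros A B C D (real_complex R (lambda k))) ->
  let Vg := Vstar_g td A B C D in
  let h := \dim Vg in
  problem3_solvable td A B C D lambda <->
  forall S : {set 'I_p},
    h%:Z - (n%:Z - p%:Z) < #|S|%:Z ->
    n%:Z - p%:Z + #|S|%:Z
      <= (\dim (Vg + \sum_(j in S) Rstar A B C D j (lambda j))%VS)%:Z.
Proof.
move=> _ [rinv _ steady_nz] _ lambda_L lambda_nz Vg h.
have lambda_good j := Lgood_Cgood (lambda_L j).
have onto j := rosenbrock_onto rinv (lambda_nz j).
split=> [[F sol] S _|dims].
  have full := decoupled_span lambda_good onto sol.1 (decoupled_of_solution sol).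
  have := dim_partial_span lambda_good onto S full; rewrite -/Vg.
  have := max_card (mem S); rewrite card_ord.
  by move: (\dim _) #|S| => d s; lia.
have full : (Vg + \sum_j Rstar A B C D j (lambda j) = fullv)%VS.
  apply/eqP; rewrite eqEdim subvf dim_cV /=.
  have [nh|hn] := leqP n h; first exact: leq_trans nh (dimvS (addvSl _ _)).
  have := dims (finset.setTfor 'I_p); rewrite cardsT card_ord.
  rewrite (eq_bigl xpredT); last by move=> j; rewrite finset.in_setT.
  move: hn; rewrite /h; move: (\dim Vg) (\dim (_ + _)) => a b; lia.
have [F [stF dec]] := decoupling_exists lambda_good full.
exists F; apply: solution_of_decoupled => // r.
have [xss [uss [dyn out]]] := rosenbrock_onto rinv steady_nz 0 r.
by exists xss, uss; split=> //; apply/eqP; rewrite -subr_eq0 dyn.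
Qed.
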